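(* For every integer $g\geq 3$ there exists a planar graph $G$ of girth at least $g$ such that $\chi_{\ell}^{\star}(G)=4$.
   Context: All graphs are finite and simple. A list-assignment of a graph $G$ is a map $L$ assigning to each vertex $v$ a finite set $L(v)\subseteq\mathbb{N}$; it is $k$-fold if $|L(v)|=k$ for all $v$. An $L$-coloring is a proper coloring $c$ of $G$ with $c(v)\in L(v)$ for all $v$. For a $k$-fold list-assignment $L$, an $L$-packing is a collection of $k$ $L$-colorings $c_1,\dots,c_k$ such that for every vertex $v$ the values $c_1(v),\dots,c_k(v)$ are pairwise distinct (so they exhaust $L(v)$). The list packing number $\chi_{\ell}^{\star}(G)$ is the least integer $k\geq1$ such that every $k$-fold list-assignment of $G$ admits an $L$-packing. *)

(* Defs.v *)
From HB Require Import structures.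
From mathcomp Require Import all_boot all_order all_algebra.
From mathcomp Require Import all_classical all_reals topology normedtype.
From mathcomp Require Import Rstruct Rstruct_topology.
Set Implicit Arguments. Unset Strict Implicit. Unset Printing Implicit Defensive.
Import Order.TTheory GRing.Theory Num.Theory.

Definition simple_graph (T : finType) (e : rel T) : Prop :=
  symmetric e /\ irreflexive e.

(* Girth at least g: every cycle (sequence of >= 3 pairwise distinct
   vertices, consecutive ones adjacent, last adjacent to first) has
   length >= g.  Acyclic graphs (girth = infinity) satisfy this for all g. *)
Definition girth_at_least (T : finType) (e : rel T) (g : nat) : Prop :=
  forall s : seq T, uniq s -> (3 <= size s)%N -> cycle e s -> (g <= size s)%N.

Definition kfold_list_assignment (T : finType) (k : nat) (L : T -> seq nat) : Prop :=
  forall v, uniq (L v) /\ size (L v) = k.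

Definition L_coloring (T : finType) (e : rel T) (L : T -> seq nat) (c : T -> nat) : Prop :=
  (forall v, c v \in L v) /\ (forall u v, e u v -> c u != c v).

Definition L_packing (T : finType) (e : rel T) (k : nat) (L : T -> seq nat)
  (c : 'I_k -> T -> nat) : Prop :=
  (forall i, L_coloring e L (c i)) /\
  (forall v (i j : 'I_k), c i v = c j v -> i = j).

Definition every_kfold_packable (T : finType) (e : rel T) (k : nat) : Prop :=
  forall L : T -> seq nat, kfold_list_assignment k L ->
    exists c : 'I_k -> T -> nat, L_packing e L c.

Definition list_packing_number_eq (T : finType) (e : rel T) (k : nat) : Prop :=
  (1 <= k)%N /\ every_kfold_packable e k /\
  (forall j, (1 <= j)%N -> (j < k)%N -> ~ every_kfold_packable e j).

(* Planarity: a drawing in the Euclidean plane R x R (R = Stdlib reals, a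
   realType): distinct points for vertices; for each edge {x,y} a continuous
   injective arc f x y : [0,1] -> R^2 from p x to p y, whose interior avoids
   all vertex points, and interiors of arcs of distinct edges are disjoint.
   (Arcs f x y and f y x are both required to be valid drawings of the same
   edge; they need not coincide.) *)
Local Open Scope classical_set_scope.
Local Open Scope ring_scope.
Notation R := Rdefinitions.R.
Definition unit_interval : set R := [set t : R | 0 <= t <= 1].

Definition planar (T : finType) (e : rel T) : Prop :=
  exists (p : T -> R * R) (f : T -> T -> R -> R * R),
    injective p /\
    (forall x y, e x y ->
       {within unit_interval, continuous (f x y)} /\
       {in unit_interval &, injective (f x y)} /\
       f x y 0 = p x /\ f x y 1 = p y) /\
    (forall x y t z, e x y -> 0 < t < 1 -> f x y t <> p z) /\
    (forall x y x' y' t t', e x y -> e x' y' -> 0 < t < 1 -> 0 < t' < 1 ->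
       f x y t = f x' y' t' ->
       (x = x' /\ y = y') \/ (x = y' /\ y = x')).

(* Main.v *)
Require Import Defs.
From mathcomp Require Import all_boot.
From mathcomp Require Import all_order all_algebra.
From mathcomp Require Import all_classical all_reals topology normedtype.
From mathcomp Require Import Rstruct Rstruct_topology zify ring lra.
Set Implicit Arguments. Unset Strict Implicit. Unset Printing Implicit Defensive.

(* Write a packing of 3 colourings at a vertex as an ordering of its list. If
   two adjacent vertices have the same list, their orderings differ by a
   3-cycle, so the parity of the ordering is constant along a path of equal
   lists. If the two lists share exactly two colours and have the appropriate
   relative parity, the ordering at one end determines the other. Hence a ring
   X Y X Y ... X X of odd length whose X-vertices, and whose Y-vertices, have a
   common parity (enforced by long threads of equal lists joining them) forces
   the relative parity of X and Y: otherwise the orderings at the two adjacent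
   final X's would agree. With the lists 023, 031, 012 in cyclic order, three
   such rings force par_0 <> par_1 <> par_2 <> par_0, which is absurd. All
   threads and rings can be taken long. The graph is 2-degenerate, and a
   2-degenerate graph has list packing number at most 4, because a bipartite
   graph on 4 + 4 vertices that is the complement of two partial matchings has
   a perfect matching. Planarity is shown by a two-page book embedding. *)

Definition sym_closure (T : finType) (a : rel T) : rel T :=
  [rel x y | a x y || a y x].

(** * Book embeddings *)

Section BookEmbedding.
Import Order.TTheory GRing.Theory Num.Theory numFieldNormedType.Exports.
Local Open Scope ring_scope.

(** For nested intervals, the factors of the outer product dominate the positive factors of the
    inner one, so equal products force equal factors. *)
Lemma nested_parabolas (F : realFieldType) (a b c d x : F) :
  a < x < b -> c < x < d -> (a <= c /\ d <= b) \/ (c <= a /\ b <= d) ->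
  (x - a) * (b - x) = (x - c) * (d - x) -> a = c /\ b = d.
Proof.
move=> /andP[ax xb] /andP[cx xd] nest.
wlog: a b c d ax xb cx xd nest / a <= c /\ d <= b => [hw|[ac db] E].
  case: (nest) => h E; first exact: hw.
  by have [-> ->] := hw c d a b cx xd ax xb (or_introl h) h (esym E).
by split; nra.
Qed.

(** The curve [y = s * (x - a) * (b - x)] traversed from [a] to [b]; exchanging [a] and [b] reverses
    the same curve, so an edge may be drawn in either direction. *)
Definition parabola (s a b : R) (t : R) : R * R :=
  (a + t * (b - a), s * (t * (b - a) * ((1 - t) * (b - a)))).

Lemma continuous_parabola s a b : continuous (parabola s a b).
Proof.
have h1 (K : realType) (c d : K) : continuous (fun t : K => c + t * d).
  move=> t; apply: cvgD; first exact: cvg_cst.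
  by apply: cvgM; [exact: cvg_id|exact: cvg_cst].
have h2 (K : realType) (c d : K) :
    continuous (fun t : K => c * (t * d * ((1 - t) * d))).
  move=> t; apply: cvgM; first exact: cvg_cst.
  apply: cvgM; apply: cvgM; try exact: cvg_cst; first exact: cvg_id.
  by apply: cvgB; [exact: cvg_cst|exact: cvg_id].
by move=> t; exact: (cvg_pair (h1 R a (b - a) t) (h2 R s (b - a) t)).
Qed.

Definition page_sign (b : bool) : R := if b then 1 else -1.

(* A two-page book embedding is a planar drawing: put the vertices on a line
   and draw an edge between [a] and [b] as an arc of [y = +-(x - a) (b - x)];
   such arcs over nested intervals meet only on the line. *)
Lemma planar_book (T : finType) (arc page : rel T) (pos : T -> nat) :
  injective pos ->
  (forall x y, arc x y -> pos x < pos y)%N ->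
  (forall x y z t, arc x y -> arc z t -> page x y = page z t ->
     ~ (pos x < pos z < pos y /\ pos y < pos t)%N) ->
  planar (sym_closure arc).
Proof.
move=> pos_inj arc_lt nocross.
pose q (x : T) : R := (pos x)%:R.
have q_inj : injective q by move=> x y /eqP; rewrite eqr_nat => /eqP /pos_inj.
have q_lt x y : (q x < q y) = (pos x < pos y)%N by rewrite ltr_nat.
have q_le x y : (q x <= q y) = (pos x <= pos y)%N by rewrite ler_nat.
have e_neq x y : sym_closure arc x y -> q y - q x != 0.
  rewrite subr_eq0 /= => /orP[] /arc_lt; rewrite -q_lt; lra.
pose sgn x y := page_sign (if arc x y then page x y else page y x).
have sgn0 x y : sgn x y != 0.
  by rewrite /sgn; case: ifP; case: (page _ _); rewrite /= ?oppr_eq0 oner_eq0.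
exists (fun x => (q x, 0)), (fun x y => parabola (sgn x y) (q x) (q y)).
split; first by move=> x y [/q_inj].
split; [|split].
- move=> x y exy; have d0 := e_neq _ _ exy; split.
    by apply: continuous_subspaceT; exact: continuous_parabola.
  split; last by rewrite /parabola; split; congr pair; ring.
  by move=> t t' _ _ /= [/addrI /(mulIf d0)].
- move=> x y t z exy /andP[t0 t1] [_ /eqP]; rewrite !mulf_eq0 (negPf (sgn0 _ _)).
  rewrite (negPf (e_neq _ _ exy)) /= !orbF; lra.
- have main (x y z u : T) X : arc x y -> arc z u -> page x y = page z u ->
    q x < X < q y -> q z < X < q u ->
    (X - q x) * (q y - X) = (X - q z) * (q u - X) -> x = z /\ y = u.
    move=> axy azu pg hX hX' E.
    have h1 := nocross _ _ _ _ axy azu pg.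
    have h2 := nocross _ _ _ _ azu axy (esym pg).
    (* Both intervals contain [X], so they overlap; as they do not cross, they are nested. *)
    have hxu : (pos x < pos u)%N by rewrite -q_lt; lra.
    have hzy : (pos z < pos y)%N by rewrite -q_lt; lra.
    have [/q_inj -> /q_inj ->] // : q x = q z /\ q y = q u.
    apply: (nested_parabolas hX hX') => //; rewrite !q_le; lia.
  move=> x y x' y' t t' exy exy' ht ht' [EX EY].
  have orient (a b : T) (s : R) : sym_closure arc a b -> 0 < s < 1 ->
    exists c d, [/\ arc c d, (c = a /\ d = b) \/ (c = b /\ d = a),
      q c < q a + s * (q b - q a) < q d,
      sgn a b = page_sign (page c d) &
      s * (q b - q a) * ((1 - s) * (q b - q a)) =
      (q a + s * (q b - q a) - q c) * (q d - (q a + s * (q b - q a)))].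
    rewrite /sym_closure /= /sgn; case: ifP => [ab _|_ /= ba] hs.
      have := arc_lt _ _ ab; rewrite -q_lt => lt_ab.
      by exists a, b; split=> //; [left|nra|ring].
    have := arc_lt _ _ ba; rewrite -q_lt => lt_ba.
    by exists b, a; split=> //; [right|nra|ring].
  have [c [d [acd cd hX Ep Eh]]] := orient _ _ _ exy ht.
  have [c' [d' [acd' cd' hX' Ep' Eh']]] := orient _ _ _ exy' ht'.
  move: EX EY hX' Eh' => /= <-; rewrite {}Eh {}Ep {}Ep'.
  move: (_ + _) hX => X hX EY hX' Eh'; rewrite {}Eh' in EY.
  have [acdX acdX'] : 0 < (X - q c) * (q d - X) /\ 0 < (X - q c') * (q d' - X).
    by split; apply: mulr_gt0; rewrite subr_gt0; lra.
  (* On different pages the two ordinates would have opposite signs. *)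
  have pg : page c d = page c' d'.
    move: EY; rewrite /page_sign.
    by case: (page c d); case: (page c' d') => //; lra.
  have [] : c = c' /\ d = d'.
    apply: (main _ _ _ _ _ acd acd' pg hX hX').
    by move: EY; rewrite pg /page_sign; case: ifP => _; lra.
  by case: cd => -[-> ->]; case: cd' => -[-> ->] -> ->; [left|right|right|left].
Qed.

End BookEmbedding.

(** * Two-degenerate graphs *)

Definition differ (s t : seq nat) := all2 (fun a b => a != b) s t.
(** Words over 0..4. Letters 0 to 3 are places in a list of four colours; 4, the value of [index] on
    an absent colour, means no place. *)
Fixpoint codes n :=
  if n is n'.+1 then [seq a :: s | a <- iota 0 5, s <- codes n'] else [:: [::]].

Lemma partial_perm_extends s : size s = 4 -> all (fun a => a < 5) s ->
  uniq [seq a <- s | a != 4] ->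
  exists2 t, perm_eq t (iota 0 4) & all2 (fun a b => (a == 4) || (a == b)) s t.
Proof.
move=> s4 sb us.
have: all (fun s => uniq [seq a <- s | a != 4] ==>
  has (fun t => all2 (fun a b => (a == 4) || (a == b)) s t)
    (permutations (iota 0 4))) (codes 4) by vm_compute.
have cod : forall n s, size s = n -> all (fun a => a < 5) s -> s \in codes n.
  elim=> [|n IH] [|a s'] // [sz] /andP[a5 s5].
  apply: (@allpairs_f _ _ _ cons (iota 0 5)); last exact: IH.
  by rewrite mem_iota.
move=> /allP/(_ s (cod 4 s s4 sb)); rewrite us => /hasP[t].
by rewrite mem_permutations => h1 h2; exists t.
Qed.

(** Each place excludes at most two of the four values, and each value is excluded from at most two
    places, so Hall's condition holds. With three values it can fail. *)
Lemma perm4_avoid s t : perm_eq s (iota 0 4) -> perm_eq t (iota 0 4) ->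
  exists2 u, perm_eq u (iota 0 4) & differ u s && differ u t.
Proof.
rewrite -!mem_permutations => sP tP.
have: all (fun s => all (fun t => has (fun u => differ u s && differ u t)
  (permutations (iota 0 4))) (permutations (iota 0 4))) (permutations (iota 0 4)).
  by vm_compute.
move=> /allP/(_ s sP)/allP/(_ t tP)/hasP[u uP h].
by exists u; rewrite // -mem_permutations.
Qed.

(** [x] only witnesses that [S] is nonempty; [u1] and [u2] may coincide or lie outside [S]. *)
Definition two_degenerate (T : finType) (e : rel T) :=
  forall (S : {set T}) x, x \in S -> exists2 v, v \in S &
    exists u1 u2, forall u, u \in S -> e v u -> u = u1 \/ u = u2.

Lemma all2_nth (S T : Type) (r : S -> T -> bool) x0 y0 s t i :
  all2 r s t -> i < size s -> r (nth x0 s i) (nth y0 t i).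
Proof. by elim: s t i => [|x s IH] [|y t] [|i] //= /andP[] // _ /IH; apply. Qed.

(* A packed neighbour [d] forbids at most one position of [l] to each colouring;
   [t] completes this partial injection to a permutation of the positions. *)
Lemma forbidden_positions (l : seq nat) (d : 'I_4 -> nat) :
  size l = 4 -> injective d ->
  exists2 t, perm_eq t (iota 0 4) &
    forall i : 'I_4, d i \in l -> index (d i) l = nth 0 t i.
Proof.
move=> l4 d_inj; have ltl i : (index (d i) l != 4) = (d i \in l).
  by rewrite -index_mem l4; have := index_size (d i) l; rewrite l4; lia.
have [|||t tP st] := @partial_perm_extends [seq index (d i) l | i <- enum 'I_4].
- by rewrite size_map size_enum_ord.
- by apply/allP => _ /mapP[i _ ->]; have := index_size (d i) l; rewrite l4; lia.
- rewrite filter_map map_inj_in_uniq; first exact: (filter_uniq _ (enum_uniq _)).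
  move=> i j;
  rewrite !mem_filter /= !ltl => /andP[il _] /andP[jl _] E; apply: d_inj.
  by rewrite -(nth_index 0 il) -(nth_index 0 jl) E.
exists t => // i; rewrite -ltl => il.
have := all2_nth 0 0 (i := i) st; rewrite size_map size_enum_ord => /(_ (ltn_ord i)).
rewrite (nth_map i) ?size_enum_ord // nth_ord_enum => /orP[|/eqP //].
by rewrite (negPf il).
Qed.

(** Colouring [i] takes the colour at place [nth 0 u i], where [u] avoids the places of both
    neighbours' colours; a neighbour's colour absent from [l] cannot clash. *)
Lemma pack_vertex (l : seq nat) (d1 d2 : 'I_4 -> nat) :
  uniq l -> size l = 4 -> injective d1 -> injective d2 ->
  exists c : 'I_4 -> nat, [/\ injective c, forall i, c i \in l,
    forall i, c i != d1 i & forall i, c i != d2 i].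
Proof.
move=> ul l4 i1 i2.
have [t1 t1P h1] := forbidden_positions l4 i1.
have [t2 t2P h2] := forbidden_positions l4 i2.
have [u uP /andP[u1 u2]] := perm4_avoid t1P t2P.
have su : size u = 4 by rewrite (perm_size uP).
have uu : uniq u by rewrite (perm_uniq uP).
have ult (i : 'I_4) : nth 0 u i < size l.
  have : nth 0 u i \in u by rewrite mem_nth // su.
  by rewrite (perm_mem uP) mem_iota l4.
exists (fun i => nth 0 l (nth 0 u i)); split.
- move=> i j /eqP; rewrite nth_uniq // nth_uniq ?su // => /eqP; exact: val_inj.
- by move=> i; rewrite mem_nth.
- move=> i; apply/eqP => E; have := all2_nth 0 0 (i := i) u1.
  by rewrite su -h1 -E ?mem_nth // index_uniq // eqxx => /(_ (ltn_ord i)).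
- move=> i; apply/eqP => E; have := all2_nth 0 0 (i := i) u2.
  by rewrite su -h2 -E ?mem_nth // index_uniq // eqxx => /(_ (ltn_ord i)).
Qed.

Lemma two_degenerate_packable (T : finType) (e : rel T) :
  simple_graph e -> two_degenerate e -> every_kfold_packable e 4.
Proof.
move=> [esym eirr] deg L Lk.
(* The values exhaust the list at every vertex, but properness is required only inside [S]. Thus
   [pack_vertex] applies even if [u1] or [u2] lies outside [S]. *)
suff main n (S : {set T}) : #|S| = n -> exists c : 'I_4 -> T -> nat,
    [/\ forall v, injective (c^~ v), forall i v, c i v \in L v &
     forall i u v, u \in S -> v \in S -> e u v -> c i u != c i v].
  have [c [c_inj cL cE]] := main _ [set: T] erefl; exists c; split.
    by move=> i; split=> // u v; apply: cE; rewrite inE.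
  by move=> v i j; apply: c_inj.
elim: n S => [|n IH] S Sn.
  exists (fun i v => nth 0 (L v) i); split.
  - move=> v i j /eqP; have [uL sL] := Lk v.
    by rewrite nth_uniq ?sL // => /eqP; exact: val_inj.
  - by move=> i v; have [_ sL] := Lk v; rewrite mem_nth ?sL.
  - by move=> i u v uS; move: (card0_eq Sn u); rewrite uS.
have /card_gt0P[x xS] : 0 < #|S| by rewrite Sn.
have [v vS [u1 [u2 vu]]] := deg S x xS.
have [|c [c_inj cL cE]] := IH (S :\ v).
  by move: (cardsD1 v S); rewrite vS Sn => -[].
have [uL sL] := Lk v.
have [d [d_inj dL d1 d2]] := pack_vertex uL sL (c_inj u1) (c_inj u2).
have dE i u : u \in S -> e v u -> d i != c i u by move=> uS /(vu u uS)[] ->.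
exists (fun i w => if w == v then d i else c i w); split.
- by move=> w; case: eqP => _; [exact: d_inj|exact: c_inj].
- by move=> i w; case: eqP => [->|_].
move=> i a b aS bS eab /=.
case: (eqVneq a v) => [Ea|av]; case: (eqVneq b v) => [Eb|bv].
- by move: eab; rewrite Ea Eb eirr.
- by apply: dE; rewrite // -Ea.
- by rewrite eq_sym; apply: dE; rewrite // esym -Eb.
- by apply: cE; rewrite ?in_setD1 ?av ?bv.
Qed.

(** Reduces the girth bound to vertex sets in which every vertex has two neighbours; the cyclic
    order is then forgotten. *)
Lemma cycle_two_neighbors (T : eqType) (e : rel T) s x :
  symmetric e -> uniq s -> 2 < size s -> cycle e s -> x \in s ->
  exists y z, [/\ y \in s, z \in s, y != z, e x y & e x z].
Proof.
move=> esym us s3 cs xs; have [i p Ep] := rot_to xs.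
have mem y : y \in x :: p -> y \in s by rewrite -Ep mem_rot.
move: us s3 cs; rewrite -(rot_uniq i) -(size_rot i) -(rot_cycle i) Ep.
case: p mem {Ep} => [|y [|z p]] // mem /= /and3P[_ yp _] _.
rewrite rcons_path => /and3P[xy _ /andP[_ zx]].
exists y, (last z p); split=> //.
- by apply: mem; rewrite !inE eqxx orbT.
- by apply: mem; rewrite !(in_cons _ _ (last z p)) -in_cons mem_last !orbT.
- by apply: contraNneq yp => ->; rewrite mem_last.
- by rewrite esym.
Qed.

(** * The graph *)

(* Three strips of [w] ring vertices [(n, 0)] each; a thread
   [(n, 0), (n, 1), ..., (n, k), (n + 2, 0)] hangs at every ring vertex. The
   last two cases are the chords closing the three rings, and the edge that
   leads the thread of the very last ring vertex back to the first strip. *)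
Definition strip_arc w k (x y : nat * nat) : bool :=
  [|| (y.1 == x.1) && (y.2 == x.2.+1),
      [&& x.2 == 0, y.2 == 0 & y.1 == x.1.+1],
      [&& x.2 == k, y.2 == 0 & y.1 == x.1.+2],
      [&& x.1 \in [:: 0; w; 2 * w], x.2 == 0, y.2 == 0 & y.1 == x.1 + w.-1] |
      [&& x.1 == 1, x.2 == 0, y.1 == (3 * w).-1 & y.2 == k]].

Definition strip_adj w k x y := strip_arc w k x y || strip_arc w k y x.

Variant strip_arc_spec w k : nat -> nat -> nat -> nat -> Prop :=
| ArcThread n i : strip_arc_spec w k n i n i.+1
| ArcRing n : strip_arc_spec w k n 0 n.+1 0
| ArcThreadEnd n : strip_arc_spec w k n k n.+2 0
| ArcChord0 : strip_arc_spec w k 0 0 w.-1 0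
| ArcChord1 : strip_arc_spec w k w 0 (w + w.-1) 0
| ArcChord2 : strip_arc_spec w k (2 * w) 0 (2 * w + w.-1) 0
| ArcLink : strip_arc_spec w k 1 0 (3 * w).-1 k.

(** * Adjacency and girth in coordinates *)

Lemma strip_arcP w k n i m j :
  strip_arc w k (n, i) (m, j) -> strip_arc_spec w k n i m j.
Proof.
rewrite /strip_arc !inE /= => /orP[/andP[/eqP-> /eqP->]|]; first exact: ArcThread.
case/or4P=> [/and3P[/eqP-> /eqP-> /eqP->]|/and3P[/eqP-> /eqP-> /eqP->]||].
- exact: ArcRing.
- exact: ArcThreadEnd.
- by case/and4P=> /or3P[] /eqP-> /eqP-> /eqP-> /eqP->; constructor.
- by case/and4P=> /eqP-> /eqP-> /eqP-> /eqP->; constructor.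
Qed.

Lemma strip_adj_thread w k n i y : 0 < i <= k -> y.1 < 3 * w -> y.2 <= k ->
  strip_adj w k (n, i) y ->
  y = (n, i.-1) \/
  y = if i < k then (n, i.+1) else
      if n == (3 * w).-1 then (1, 0) else (n.+2, 0).
Proof.
case: y => a b /= ik a3 bk /orP[] /strip_arcP adj.
  right; move: ik a3 bk; case: adj => // *; rewrite ?ltnn; case: ifP => ? //; lia.
case: adj ik a3 bk => // *; first by left.
by right; rewrite ltnn eqxx.
Qed.

Lemma strip_adj_ring w k n m : 0 < k -> strip_adj w k (n, 0) (m, 0) ->
  [\/ m = n.+1, n = m.+1, n \in [:: 0; w; 2 * w] /\ m = n + w.-1 |
      m \in [:: 0; w; 2 * w] /\ n = m + w.-1].
Proof.
have spec n' m' i j : i = 0 -> j = 0 -> 0 < k -> strip_arc_spec w k n' i m' j ->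
    m' = n'.+1 \/ n' \in [:: 0; w; 2 * w] /\ m' = n' + w.-1.
  move=> i0 j0 k0 adj; move: i0 j0 k0; case: adj => //; try by [left].
  - by move=> ? ->.
  - by right; rewrite inE.
  - by right; rewrite !inE eqxx orbT.
  - by right; rewrite !inE eqxx !orbT.
  - by move=> _ ->.
move=> k0 /orP[] /strip_arcP/spec => /(_ erefl erefl k0) [];
  by [constructor 1|constructor 3|constructor 2|constructor 4].
Qed.

(** If [s] meets the inside of a thread, degree two propagates along all its [k + 1] vertices.
    Otherwise [s] consists of ring vertices and contains a whole ring of [w] vertices. *)
Lemma strip_girth w k (s : seq (nat * nat)) x : 3 < w -> 0 < k ->
  (forall y, y \in s -> y.1 < 3 * w /\ y.2 <= k) ->
  (forall y, y \in s -> exists z t,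
     [/\ z \in s, t \in s, z != t, strip_adj w k y z & strip_adj w k y t]) ->
  x \in s -> minn w k.+1 <= size s.
Proof.
move=> w3 k0 bnd deg xs.
have pick2 (z t p q : nat * nat) : z \in s -> t \in s -> z != t ->
    z = p \/ z = q -> t = p \/ t = q -> p \in s /\ q \in s.
  by move=> zs ts zt [] Ez [] Et; move: zs ts zt; rewrite Ez Et ?eqxx.
have [/hasP[[n i] nis /= i0]|nothread] :=
  boolP (has (fun y => y.2 != 0) s).
  (* the whole thread at [n] lies in [s] *)
  have step j : 0 < j <= k -> (n, j) \in s ->
      (n, j.-1) \in s /\ (j < k -> (n, j.+1) \in s).
    move=> jk /deg [z [t [zs ts zt az at_]]].
    have [[z1 z2] [t1 t2]] := (bnd _ zs, bnd _ ts).
    have [] := pick2 _ _ _ _ zs ts zt (strip_adj_thread jk z1 z2 az)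
      (strip_adj_thread jk t1 t2 at_).
    by move=> ? h; split=> // jk'; rewrite jk' in h.
  have [_ /= ik] := bnd _ nis.
  have down d : d <= i -> (n, i - d) \in s.
    elim: d => [|d IH] di; first by rewrite subn0.
    have [|+ _] := step (i - d) _ (IH (ltnW di)); first lia.
    by rewrite -subnS.
  have up d : i + d <= k -> (n, i + d) \in s.
    elim: d => [|d IH] di; first by rewrite addn0.
    have [||_] := step (i + d); [lia|by apply: IH; lia|].
    by rewrite addnS; apply; lia.
  rewrite geq_min; apply/orP; right.
  have <- : size [seq (n, j) | j <- iota 0 k.+1] = k.+1.
    by rewrite size_map size_iota.
  apply: uniq_leq_size; first by rewrite map_inj_uniq ?iota_uniq // => a b [].
  move=> y /mapP[j]; rewrite mem_iota => jk ->.
  have [ij|ji] := leqP i j.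
    by rewrite -(subnKC ij); apply: up; lia.
  by rewrite -(subKn (ltnW ji)); apply: down; lia.
have ring0 y : y \in s -> y.2 = 0.
  by move=> ys; apply/eqP; apply: contraNT nothread => y0; apply/hasP; exists y.
have degr n : (n, 0) \in s -> exists z t, [/\ (z, 0) \in s, (t, 0) \in s, z != t,
    strip_adj w k (n, 0) (z, 0) & strip_adj w k (n, 0) (t, 0)].
  case/deg=> -[z z0] [[t t0] [zs ts]].
  have /= Ez := ring0 _ zs; have /= Et := ring0 _ ts; subst.
  by rewrite xpair_eqE eqxx andbT => *; exists z, t.
have exn : exists n, (n, 0) \in s.
  by exists x.1; rewrite -(ring0 x xs) -surjective_pairing.
have bn n : (n, 0) \in s -> n <= 3 * w by case/bnd=> /ltnW.
case: (ex_maxnP exn bn) => n ns nmax.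
(* the largest ring vertex of [s] closes a chord *)
have [m [mw nE n1s]] : exists m,
    [/\ m \in [:: 0; w; 2 * w], n = m + w.-1 & (n.-1, 0) \in s].
  have [z [t [zs ts zt az at_]]] := degr _ ns.
  have [zn tn] := (nmax _ zs, nmax _ ts).
  case: (strip_adj_ring k0 az) => [E|E|[_ E]|[zw E]]; try lia.
    case: (strip_adj_ring k0 at_) => [E'|E'|[_ E']|[tw E']]; try lia.
    by exists t; split=> //; rewrite E.
  case: (strip_adj_ring k0 at_) => [E'|E'|[_ E']|[tw E']]; try lia.
  by exists z; split=> //; rewrite E'.
have down d : d < w -> (m + w.-1 - d, 0) \in s.
  elim: d => [|[|d] IH] dw; first by rewrite subn0 -nE.
    by rewrite -nE subn1.
  have [z [t [zs ts zt az at_]]] := degr _ (IH (ltnW dw)).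
  (* This vertex lies strictly between the ends of the chord, so no chord starts or ends at it. *)
  have inner u : strip_adj w k (m + w.-1 - d.+1, 0) (u, 0) ->
      u = (m + w.-1 - d.+1).+1 \/ u = m + w.-1 - d.+2.
    case/(strip_adj_ring k0) => [->|E|[]|[]]; first by left.
    - by right; lia.
    - by move: mw; rewrite !inE; lia.
    - by move: mw; rewrite !inE; lia.
  have pr (u v v' : nat) : u = v \/ u = v' -> (u, 0) = (v, 0) \/ (u, 0) = (v', 0).
    by case=> ->; [left|right].
  have zt' : (z, 0) != (t, 0) by rewrite xpair_eqE eqxx andbT.
  by have [] := pick2 _ _ _ _ zs ts zt'
    (pr z _ _ (inner z az)) (pr t _ _ (inner t at_)).
rewrite geq_min; apply/orP; left.
have <- : size [seq (m + w.-1 - d, 0) | d <- iota 0 w] = w.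
  by rewrite size_map size_iota.
apply: uniq_leq_size.
  rewrite map_inj_in_uniq ?iota_uniq // => a b; rewrite !mem_iota => ha hb [E].
  by lia.
by move=> y /mapP[d]; rewrite mem_iota => dw ->; apply: down.
Qed.

(** * The finite graph and its planar drawing *)

Definition strip_vertex w k := ('I_(3 * w).-1.+1 * 'I_k.+1)%type.

Definition coords w k (x : strip_vertex w k) : nat * nat :=
  (nat_of_ord x.1, nat_of_ord x.2).

Definition strip w k : rel (strip_vertex w k) :=
  relpre (@coords w k) (strip_arc w k).

Lemma coords_inj w k : injective (@coords w k).
Proof. by move=> [a b] [c d] [/ord_inj -> /ord_inj ->]. Qed.

Lemma coords_bound w k (x : strip_vertex w k) :
  0 < w -> (coords x).1 < 3 * w /\ (coords x).2 <= k.
Proof. by case: x => a b /= w0; have := ltn_ord a; have := ltn_ord b; lia. Qed.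

(** Along the spine each ring vertex is followed by its own thread. *)
Definition position w k (x : strip_vertex w k) : nat := x.1 * k.+1 + x.2.

Lemma position_lt w k (x y : strip_vertex w k) :
  (position x < position y) =
  (x.1 < y.1) || (x.1 == y.1 :> nat) && (x.2 < y.2).
Proof.
rewrite /position; have := ltn_ord x.2; have := ltn_ord y.2.
case: (ltngtP x.1 y.1) => [lt|lt|->] *; last by rewrite ltn_add2l.
  by have := leq_mul2r k.+1 x.1.+1 y.1; rewrite lt orbT mulSn; lia.
by have := leq_mul2r k.+1 y.1.+1 x.1; rewrite lt orbT mulSn; lia.
Qed.

Lemma position_inj w k : injective (@position w k).
Proof.
move=> x y E; have := position_lt x y; have := position_lt y x.
rewrite E ltnn => h1 h2; apply: coords_inj; rewrite /coords.
by congr pair; move: h1 h2; lia.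
Qed.

Lemma strip_position w k (x y : strip_vertex w k) :
  3 < w -> 0 < k -> strip x y -> position x < position y.
Proof.
move=> w3 k0 /strip_arcP; rewrite position_lt.
by case: {x y}_ / => *; lia.
Qed.

(** The thread end leaving [n] crosses the one leaving [n + 1] and the ring edge from [n]; this rule
    separates them. As [w] is odd, it also separates each chord from the thread ends passing over
    its two ends. *)
Definition strip_page w k (x y : strip_vertex w k) : bool :=
  odd x.1 (+) (y.1 == x.1.+1 :> nat).

Lemma strip_noncrossing w k (x y z t : strip_vertex w k) :
  odd w -> 3 < w -> 0 < k -> strip x y -> strip z t ->
  strip_page x y = strip_page z t ->
  ~ (position x < position z < position y /\ position y < position t).
Proof.
move=> ow w3 k0 xy zt; rewrite !position_lt /strip_page.
have [bx bx'] := coords_bound x (ltnW (ltnW (ltnW w3))).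
have [by_ by'] := coords_bound y (ltnW (ltnW (ltnW w3))).
have [bz bz'] := coords_bound z (ltnW (ltnW (ltnW w3))).
have [bt bt'] := coords_bound t (ltnW (ltnW (ltnW w3))).
move: (strip_arcP xy) (strip_arcP zt) bx bx' by_ by' bz bz' bt bt'.
rewrite /=; case: x xy => x1 x2 _ /=; case: y => y1 y2 /=.
case: z zt => z1 z2 _ /=; case: t => t1 t2 /=.
move: {x1 x2 y1 y2 z1 z2 t1 t2} (nat_of_ord x1) (nat_of_ord x2) (nat_of_ord y1)
  (nat_of_ord y2) (nat_of_ord z1) (nat_of_ord z2) (nat_of_ord t1) (nat_of_ord t2).
move=> x1 x2 y1 y2 z1 z2 t1 t2.
(* Forty-nine pairs of arc kinds, each a problem of linear arithmetic with parity. *)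
case=> [n i|n|n||||]; case=> [n' i'|n'|n'||||] *; lia.
Qed.

Lemma strip_planar w k : odd w -> 3 < w -> 0 < k ->
  planar (sym_closure (@strip w k)).
Proof.
move=> ow w3 k0; apply: (planar_book (page := @strip_page w k) (@position_inj w k)).
- by move=> x y; exact: strip_position.
- by move=> x y z t; exact: strip_noncrossing.
Qed.

Lemma strip_simple w k : 3 < w -> 0 < k ->
  simple_graph (sym_closure (@strip w k)).
Proof.
move=> w3 k0; split; first by move=> x y; rewrite /sym_closure /= orbC.
move=> x; rewrite /sym_closure /= orbb; apply/negbTE/negP.
by move/(strip_position w3 k0); rewrite ltnn.
Qed.

Lemma sym_closure_strip w k (x y : strip_vertex w k) :
  sym_closure (@strip w k) x y = strip_adj w k (coords x) (coords y).
Proof. by []. Qed.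

(** * Girth and 2-degeneracy of the finite graph *)

Lemma strip_girth_at_least w k : 3 < w -> 0 < k ->
  girth_at_least (sym_closure (@strip w k)) (minn w k.+1).
Proof.
move=> w3 k0 s us s3 cs.
have [x xs] : exists x, x \in s.
  by case: s s3 {us cs} => // x s _; exists x; rewrite mem_head.
rewrite -(size_map (@coords w k)); apply: (strip_girth w3 k0 (x := coords x)).
- by move=> _ /mapP[y _ ->]; apply: coords_bound; lia.
- move=> _ /mapP[y ys ->].
  have [esym _] := strip_simple w3 k0.
  have [z [t [zs ts zt yz yt]]] := cycle_two_neighbors esym us s3 cs ys.
  exists (coords z), (coords t); split=> //; try exact: map_f.
- exact: map_f.
Qed.

(** [inord] needs a visible successor as bound, hence [(3 * w).-1.+1] in [strip_vertex]. *)
Definition vertex_at w k n i : strip_vertex w k := (inord n, inord i).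

Lemma coords_vertex_at w k n i : n < 3 * w -> i <= k ->
  coords (vertex_at w k n i) = (n, i).
Proof. by move=> hn hi; rewrite /coords /= !inordK //; lia. Qed.

Lemma vertex_at_coords w k (x : strip_vertex w k) n i :
  coords x = (n, i) -> x = vertex_at w k n i.
Proof. by case: x => a b [<- <-]; rewrite /vertex_at !inord_val. Qed.

(** A thread vertex has at most two neighbours. If [S] has only ring vertices, the largest one sees
    at most its predecessor and the lower end of a chord. *)
Lemma strip_two_degenerate w k : 3 < w -> 0 < k ->
  two_degenerate (sym_closure (@strip w k)).
Proof.
move=> w3 k0 S x xS; have w0 : 0 < w by lia.
have [v /andP[vS v2]|ring] := pickP [pred v in S | v.2 != 0 :> nat].
  exists v => //; have [_ vk] := coords_bound v w0.
  have vik : 0 < (coords v).2 <= k by rewrite lt0n v2.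
  exists (vertex_at w k (coords v).1 (coords v).2.-1).
  set q := if (coords v).2 < k then ((coords v).1, (coords v).2.+1) else
    if (coords v).1 == (3 * w).-1 then (1, 0) else ((coords v).1.+2, 0).
  exists (vertex_at w k q.1 q.2) => u uS; rewrite sym_closure_strip.
  rewrite [coords v]surjective_pairing; have [u1 u2] := coords_bound u w0.
  case/(strip_adj_thread vik u1 u2) => E; [left|right]; apply: vertex_at_coords => //.
  by rewrite E -surjective_pairing.
have ring0 u : u \in S -> coords u = (nat_of_ord u.1, 0).
  by move=> uS; have := ring u; rewrite /= uS /coords => /negbFE/eqP ->.
case: (arg_maxnP (fun v : strip_vertex w k => nat_of_ord v.1) xS) => v vS vmax.
exists v => //.
exists (vertex_at w k v.1.-1 0), (vertex_at w k (v.1 - w.-1) 0) => u uS.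
rewrite sym_closure_strip (ring0 v vS) (ring0 u uS).
have /= uv := vmax u uS.
case/(strip_adj_ring k0) => [E|E|[_ E]|[_ E]].
- by exfalso; lia.
- by left; apply: vertex_at_coords; rewrite (ring0 u uS) E.
- by exfalso; lia.
- by right; apply: vertex_at_coords; rewrite (ring0 u uS) E addnK.
Qed.

(** * No packing of fewer than four colourings *)

(** The colour rotation 2 -> 3 -> 1 -> 2 carries each palette, in the written order, to the next one
    cyclically. *)
Definition palette (j : nat) : seq nat :=
  nth [::] [:: [:: 0; 2; 3]; [:: 0; 3; 1]; [:: 0; 1; 2]] j.
(** The rotations are the even permutations of three entries. *)
Definition even_order j s := s \in [seq rot i (palette j) | i <- iota 0 3].

(** A derangement of three points is a 3-cycle, hence even. *)
Lemma differ_even_order j s t : j < 3 ->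
  perm_eq s (palette j) -> perm_eq t (palette j) -> differ s t ->
  even_order j s = even_order j t.
Proof.
move=> j3; rewrite -!mem_permutations => sP tP st; apply/eqP; move: j3 s sP t tP st.
have: all (fun j => all (fun s => all (fun t => differ s t ==>
  (even_order j s == even_order j t)) (permutations (palette j)))
  (permutations (palette j))) (iota 0 3) by vm_compute.
move=> /allP h j3 s sP t tP st; move: (h j); rewrite mem_iota j3 => /(_ isT).
by move=> /allP/(_ s sP)/allP/(_ t tP)/implyP; apply.
Qed.

(** Three orderings of the next palette differ from [t] everywhere, and exactly one of them has the
    parity of [t]: against 023 these are 310, 301 and 130, of which only 310 is even. *)
Lemma differ_rigid j s t u : j < 3 ->
  perm_eq s (palette (j.+1 %% 3)) -> perm_eq t (palette j) ->
  perm_eq u (palette (j.+1 %% 3)) -> differ s t -> differ t u ->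
  even_order (j.+1 %% 3) s = even_order j t ->
  even_order (j.+1 %% 3) u = even_order j t -> s = u.
Proof.
move=> j3; rewrite -!mem_permutations => sP tP uP st tu es eu.
have: all (fun j => all (fun s => all (fun t => all (fun u =>
  [&& differ s t, differ t u, even_order (j.+1 %% 3) s == even_order j t &
   even_order (j.+1 %% 3) u == even_order j t] ==> (s == u))
  (permutations (palette (j.+1 %% 3)))) (permutations (palette j)))
  (permutations (palette (j.+1 %% 3)))) (iota 0 3) by vm_compute.
move=> /allP/(_ j); rewrite mem_iota j3 => /(_ isT).
move=> /allP/(_ s sP)/allP/(_ t tP)/allP/(_ u uP).
by rewrite st tu es eu !eqxx => /eqP.
Qed.

(* Strip [j] uses the palettes [j] and [j + 1] alternately; the palette of its
   last vertices is the one shared with strip [j + 1]. *)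
Definition palette_index w n := (n %/ w + ~~ odd (n %% w)) %% 3.

Lemma palette_index_strip w j i : i < w ->
  palette_index w (j * w + i) = (j + ~~ odd i) %% 3.
Proof.
move=> iw; have w0 : 0 < w by lia.
by rewrite /palette_index divnMDl // modnMDl (divn_small iw) (modn_small iw) addn0.
Qed.

Lemma packing_perm (T : finType) (e : rel T) (L : T -> seq nat) c v :
  kfold_list_assignment 3 L -> @L_packing T e 3 L c ->
  perm_eq [seq c i v | i <- enum 'I_3] (L v).
Proof.
move=> Lk [cL c_inj]; have [uL sL] := Lk v.
have us : uniq [seq c i v | i <- enum 'I_3].
  by rewrite map_inj_uniq ?enum_uniq // => i j /c_inj.
apply: uniq_perm => //.
have sub : {subset [seq c i v | i <- enum 'I_3] <= L v}.
  by move=> _ /mapP[i _ ->]; have [h _] := cL i; exact: h.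
have sz : size (L v) <= size [seq c i v | i <- enum 'I_3].
  by rewrite sL size_map size_enum_ord.
by have [] := uniq_min_size us sub sz.
Qed.

Lemma packing_differ (T : finType) (e : rel T) k L c u v :
  @L_packing T e k L c -> e u v ->
  differ [seq c i u | i <- enum 'I_k] [seq c i v | i <- enum 'I_k].
Proof.
move=> [cL _] euv; rewrite /differ.
by elim: (enum 'I_k) => //= i s ->; have [_ h] := cL i; rewrite h.
Qed.

(** [ring_odd] separates [par (j * w)] from [par (j * w).+1]; [step] and [last] identify the latter
    with the value of [par] at the start of the cyclically preceding strip. Three booleans would
    then be pairwise distinct. *)
Lemma strip_not_3_packable w k : odd w -> 3 < w -> 0 < k ->
  ~ every_kfold_packable (sym_closure (@strip w k)) 3.
Proof.
move=> ow w3 k0.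
pose L (x : strip_vertex w k) := palette (palette_index w x.1).
have lt3 n : palette_index w n < 3 by rewrite ltn_mod.
have Lk : kfold_list_assignment 3 L.
  by move=> x; rewrite /L; case: (palette_index w x.1) (lt3 x.1) => [|[|[|]]].
case/(_ L Lk) => c cP.
pose st n i := [seq c j (vertex_at w k n i) | j <- enum 'I_3].
have stP n i : n < 3 * w -> i <= k ->
    perm_eq (st n i) (palette (palette_index w n)).
  move=> hn hi; have := packing_perm (vertex_at w k n i) Lk cP.
  by rewrite /L /vertex_at /= inordK //; lia.
have stD n i m j : n < 3 * w -> i <= k -> m < 3 * w -> j <= k ->
    strip_adj w k (n, i) (m, j) -> differ (st n i) (st m j).
  move=> hn hi hm hj adj; apply: (packing_differ cP).
  by rewrite sym_closure_strip !coords_vertex_at.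
have adjI x y : strip_arc w k x y -> strip_adj w k x y by rewrite /strip_adj => ->.
have adjJ x y : strip_arc w k x y -> strip_adj w k y x.
  by rewrite /strip_adj => ->; rewrite orbT.
pose par n := even_order (palette_index w n) (st n 0).
have thread n i : n < 3 * w -> i <= k ->
    even_order (palette_index w n) (st n i) = par n.
  move=> hn; elim: i => // i IH hi; rewrite -(IH (ltnW hi)).
  apply/esym/differ_even_order => //; try by apply: stP => //; exact: ltnW.
  apply: stD => //; try exact: ltnW.
  by apply: adjI; rewrite /strip_arc /= !eqxx.
have par2 n : n.+2 < 3 * w -> palette_index w n = palette_index w n.+2 ->
    par n = par n.+2.
  move=> hn E; have hn' : n < 3 * w by lia.
  rewrite -(thread n k) // /par -E; apply: differ_even_order => //.
  - exact: stP.
  - by rewrite E; exact: stP.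
  - by apply: stD => //; apply: adjI; rewrite /strip_arc /= !eqxx !orbT.
have ltw j i : j < 3 -> i < w -> j * w + i < 3 * w.
  by case: j => [|[|[|]]] //; lia.
have in_strip j i : j < 3 -> i < w -> par (j * w + i) = par (j * w + odd i).
  move=> j3; elim/ltn_ind: i => -[|[|i]] IH iw //=.
  rewrite negbK -IH ?(ltnW (ltnW iw)) ?ltnS ?leqnSn //.
  have E : j * w + i.+2 = (j * w + i).+2 by rewrite !addnS.
  rewrite E; apply/esym/par2; rewrite -E; first exact: ltw.
  by rewrite !palette_index_strip ?(ltnW (ltnW iw)) //= negbK.
have odd_pred : odd w.-1 = false by lia.
have ring_odd j : j < 3 -> par (j * w) != par (j * w).+1.
  move=> j3; have jm : j * w \in [:: 0; w; 2 * w].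
    by case: j j3 => [|[|[|]]] // _; rewrite !inE ?mul0n ?mul1n !eqxx ?orbT.
  apply/eqP => E.
  have [b par_i] : exists b, forall i, i < w -> par (j * w + i) = b.
    exists (par (j * w)) => i iw.
    by rewrite in_strip //; case: (odd i); rewrite ?addn1 ?addn0.
  (* Under equal parities, rigidity through each odd vertex copies the ordering from one even vertex
     to the next. *)
  have const i : i.*2 < w -> st (j * w + i.*2) 0 = st (j * w) 0.
    elim: i => [|i IH] iw; first by rewrite addn0.
    have iw2 : i.*2 < w by lia.
    have iw1 : i.*2.+1 < w by lia.
    rewrite -(IH iw2); apply/esym.
    have e0 : palette_index w (j * w + i.*2) = j.+1 %% 3.
      by rewrite palette_index_strip // odd_double addn1.
    have e1 : palette_index w (j * w + i.*2.+1) = j.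
      by rewrite palette_index_strip //= odd_double addn0 modn_small.
    have e2 : palette_index w (j * w + i.+1.*2) = j.+1 %% 3.
      by rewrite palette_index_strip // odd_double addn1.
    apply: (differ_rigid (t := st (j * w + i.*2.+1) 0) j3).
    - by rewrite -e0; apply: stP => //; apply: ltw.
    - by rewrite -{2}e1; apply: stP => //; apply: ltw.
    - by rewrite -e2; apply: stP => //; apply: ltw.
    - apply: stD => //; try exact: ltw.
      by apply: adjI; rewrite /strip_arc /= addnS !eqxx !orbT.
    - apply: stD => //; try exact: ltw.
      by apply: adjI; rewrite /strip_arc /= !addnS !eqxx !orbT.
    - by have := par_i _ iw2; have := par_i _ iw1; rewrite /par e0 e1 => -> ->.
    - by have := par_i _ iw; have := par_i _ iw1; rewrite /par e2 e1 => -> ->.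
  have jw : j * w < 3 * w by have := @ltw j 0 j3; rewrite addn0; apply; lia.
  have w1 : w.-1./2.*2 = w.-1 by rewrite -[RHS]odd_double_half odd_pred.
  (* The chord joins two vertices that carry the same ordering. *)
  have : differ (st (j * w) 0) (st (j * w + w.-1) 0).
    apply: stD => //; first by apply: ltw; lia.
    by apply: adjI; rewrite /strip_arc /= jm !eqxx /= !orbT.
  have := const w.-1./2; rewrite w1 => ->; last by lia.
  have : size (st (j * w) 0) = 3 by rewrite size_map size_enum_ord.
  by case: (st _ _) => //= a s; rewrite eqxx.
have step j : j < 2 -> par (j * w) = par (j.+1 * w).+1.
  move=> j2; have j3 : j < 3 by lia.
  have -> : par (j * w) = par (j * w + w.-1).
    by rewrite in_strip ?odd_pred ?addn0 //; lia.
  (* The thread from the last vertex of strip [j] ends at the second vertex of strip [j + 1]; both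
     carry palette [j + 1]. *)
  have E : (j.+1 * w).+1 = (j * w + w.-1).+2 by rewrite mulSn; lia.
  have h : j.+1 * w + 1 < 3 * w by apply: ltw; lia.
  rewrite E; apply: par2; first by rewrite -E -addn1.
  rewrite -E -addn1 !palette_index_strip ?odd_pred //=; lia.
have last : par (2 * w) = par 1.
  have -> : par (2 * w) = par (2 * w + w.-1).
    by rewrite in_strip ?odd_pred ?addn0 //; lia.
  have E : 2 * w + w.-1 = (3 * w).-1 by lia.
  have i0 : palette_index w (2 * w + w.-1) = 0.
    by rewrite palette_index_strip ?odd_pred //; lia.
  have i1 : palette_index w 1 = 0.
    by rewrite -[1]/(0 * w + 1) palette_index_strip //; lia.
  rewrite -(thread _ k) //; last by lia.
  rewrite /par i0 i1; apply: differ_even_order => //.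
  - by have := @stP (2 * w + w.-1) k; rewrite i0; apply; lia.
  - by have := @stP 1 0; rewrite i1; apply; lia.
  - apply: stD => //; try lia.
    by apply: adjJ; rewrite /strip_arc E /= !eqxx !orbT.
have := (ring_odd 0 isT, ring_odd 1 isT, ring_odd 2 isT).
move: (step 0 isT) (step 1 isT); rewrite !mul0n !mul1n => <- <-; rewrite -last.
move=> [[]].
by case: (par 0); case: (par w); case: (par (2 * w)).
Qed.

(** The first ring is an odd cycle, so not even one colouring exists from constant lists of at most
    two colours. *)
Lemma strip_not_2_packable w k j : odd w -> 3 < w -> 0 < k -> 0 < j <= 2 ->
  ~ every_kfold_packable (sym_closure (@strip w k)) j.
Proof.
move=> ow w3 k0 /andP[j0 j2] /(_ (fun=> iota 0 j)) [|c [cL _]].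
  by move=> v; rewrite iota_uniq size_iota.
have [col proper] := cL (Ordinal j0).
pose d n := c (Ordinal j0) (vertex_at w k n 0).
have d2 n : d n < 2 by have := col (vertex_at w k n 0); rewrite mem_iota /d; lia.
have dD n m : n < 3 * w -> m < 3 * w -> strip_arc w k (n, 0) (m, 0) -> d n != d m.
  move=> hn hm arc; apply: proper.
  by rewrite sym_closure_strip /strip_adj !coords_vertex_at // arc.
have dS n : n.+1 < 3 * w -> d n != d n.+1.
  move=> hn; apply: dD => //; first exact: ltnW.
  by rewrite /strip_arc /= !eqxx !orbT.
have const i : i.*2 < w -> d i.*2 = d 0.
  elim: i => // i IH iw; have iw2 : i.*2 < w by lia.
  rewrite -(IH iw2) doubleS.
  move: (dS i.*2) (dS i.*2.+1) (d2 i.*2) (d2 i.*2.+1) (d2 i.*2.+2); lia.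
have w1 : w.-1./2.*2 = w.-1 by lia.
have E : d w.-1 = d 0 by rewrite -[in LHS]w1 const // w1; lia.
suff /(dD 0 w.-1)/eqP[] : strip_arc w k (0, 0) (w.-1, 0) by rewrite ?E //; lia.
by rewrite /strip_arc /= add0n !eqxx !orbT.
Qed.

Theorem theorem4p1 : forall g : nat, (3 <= g)%N ->
  exists (T : finType) (e : rel T),
    simple_graph e /\ planar e /\ girth_at_least e g /\
    list_packing_number_eq e 4.
Proof.
move=> g g3; have k0 : 0 < g by lia.
have w3 : 3 < g.*2.+1 by lia.
have ow : odd g.*2.+1 by rewrite /= odd_double.
(* [w = 2g + 1] is odd and above 3, and the girth bound [minn w k.+1] becomes [g + 1]. *)
exists (strip_vertex g.*2.+1 g), (sym_closure (@strip g.*2.+1 g)).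
have simple := strip_simple w3 k0.
split=> //; split; first exact: strip_planar.
split; [|split; [|split]] => //.
- move=> s us s3 cs; apply: leq_trans (strip_girth_at_least w3 k0 us s3 cs).
  by lia.
- exact: two_degenerate_packable simple (strip_two_degenerate w3 k0).
- case=> [|[|[|[|j]]]] // _ _; [exact: strip_not_2_packable..|].
  exact: strip_not_3_packable.
Qed.
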